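(* Let $K[\mathcal S]$ be a simplicial semigroup ring of dimension $2$. The multigraded Hilbert series of $K[\mathcal S]$ is $$HS_{K[\mathcal S]}(t)=\frac{\sum_{s\in\mathcal S_0}t^s-\sum_{s\in\mathcal S_1}t^s}{(1-t_1^{\omega_{n-1}})(1-t_2^{\omega_n})}.$$
   Context: $K$ is an infinite field. $\mathcal A=\{a_1,\dots,a_n\}\subset\mathbb N^2$ is a set of nonzero vectors with $a_{n-1}=(\omega_{n-1},0)$, $a_n=(0,\omega_n)$, where $\omega_{n-1},\omega_n\in\mathbb Z^+$; $\mathcal S\subset\mathbb N^2$ is the semigroup (with $0$) generated by $\mathcal A$, and $K[\mathcal S]=K[t^s\mid s\in\mathcal S]$. For $s=(s_1,s_2)$, $t^s=t_1^{s_1}t_2^{s_2}$, and the multigraded Hilbert series is $HS_{K[\mathcal S]}(t)=\sum_{s\in\mathcal S}t^s$. $\mathcal S_0$ and $\mathcal S_1$ are the sets of shifts of the first and second steps of the multigraded Noether resolution of $K[\mathcal S]$ (its minimal multigraded free resolution as module over $A=K[x_{n-1},x_n]$, where $x_i\mapsto t^{a_i}$), namely $\mathcal S_0=\{s\in\mathcal S\mid s-a_{n-1}\notin\mathcal S\text{ and }s-a_n\notin\mathcal S\}$ and $\mathcal S_1=\{s\in\mathcal S\mid s-a_{n-1},\,s-a_n\in\mathcal S\text{ and }s-a_n-a_{n-1}\notin\mathcal S\}$. *)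

(* Defs.v *)
From HB Require Import structures.
From mathcomp Require Import all_boot all_order all_algebra.
From mathcomp Require Import boolp classical_sets functions cardinality fsbigop.
From mathcomp Require Import mpoly.
Set Implicit Arguments.
Unset Strict Implicit.
Unset Printing Implicit Defensive.
Import GRing.Theory.
Local Open Scope classical_set_scope.
Local Open Scope ring_scope.

(* The ring Z[[t_1, t_2]]: [f s] is the coefficient of t_1^(s.1) t_2^(s.2). *)
Definition fps2 : Type := nat * nat -> int.

HB.instance Definition _ := GRing.Zmodule.copy fps2 (nat * nat -> int).

Definition fps2_one : fps2 := fun s => (s == (0, 0)%N)%:R.

Definition fps2_mul (f g : fps2) : fps2 := fun s =>
  \sum_(i < s.1.+1) \sum_(j < s.2.+1) f (i : nat, j : nat) * g (s.1 - i, s.2 - j)%N.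

(* The ring axioms are transported from Z[t_1][t_2] by truncation. *)
Definition fps2_agree (s : nat * nat) (f : fps2) (p : {poly {poly int}}) :=
  forall i j, (i <= s.1)%N -> (j <= s.2)%N -> f (i, j) = p`_j`_i.

Definition fps2_trunc (s : nat * nat) (f : fps2) : {poly {poly int}} :=
  \poly_(j < s.2.+1) \poly_(i < s.1.+1) f (i, j).

Lemma fps2_truncP s f : fps2_agree s f (fps2_trunc s f).
Proof. by move=> i j hi hj; rewrite coef_poly ltnS hj coef_poly ltnS hi. Qed.

Lemma fps2_agree1 s : fps2_agree s fps2_one 1.
Proof.
move=> i j _ _; rewrite /fps2_one coef1 xpair_eqE.
by case: (j == 0%N); rewrite ?andbF ?coef0 // andbT coef1.
Qed.

Lemma fps2_agreeM s f g p q :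
  fps2_agree s f p -> fps2_agree s g q -> fps2_agree s (fps2_mul f g) (p * q).
Proof.
move=> fp gq i j hi hj; rewrite /fps2_mul /= coefM coef_sum exchange_big /=.
apply: eq_bigr => l _; rewrite coefM; apply: eq_bigr => k _.
have hk : (k <= i)%N by rewrite -ltnS ltn_ord.
have hl : (l <= j)%N by rewrite -ltnS ltn_ord.
rewrite fp ?gq //; first by apply: leq_trans hi; apply: leq_subr.
- by apply: leq_trans hj; apply: leq_subr.
- exact: leq_trans hk hi.
- exact: leq_trans hl hj.
Qed.

Lemma fps2_agreeD s f g p q :
  fps2_agree s f p -> fps2_agree s g q -> fps2_agree s (f + g) (p + q).
Proof. by move=> fp gq i j hi hj; rewrite !coefD -fp // -gq. Qed.

Lemma fps2_eq (f g : fps2) :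
  (forall s, exists2 p, fps2_agree s f p & fps2_agree s g p) -> f = g.
Proof.
move=> H; apply/funext => -[i j]; have [p fp gp] := H (i, j).
by rewrite fp // gp.
Qed.

Lemma fps2_mulA : associative fps2_mul.
Proof.
move=> f g h; apply: fps2_eq => s.
have T := @fps2_truncP s.
exists (fps2_trunc s f * (fps2_trunc s g * fps2_trunc s h)).
  exact: fps2_agreeM (T f) (fps2_agreeM (T g) (T h)).
rewrite mulrA; exact: fps2_agreeM (fps2_agreeM (T f) (T g)) (T h).
Qed.

Lemma fps2_mulC : commutative fps2_mul.
Proof.
move=> f g; apply: fps2_eq => s; have T := @fps2_truncP s.
exists (fps2_trunc s f * fps2_trunc s g); first exact: fps2_agreeM (T f) (T g).
rewrite mulrC; exact: fps2_agreeM (T g) (T f).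
Qed.

Lemma fps2_mul1 : left_id fps2_one fps2_mul.
Proof.
move=> f; apply: fps2_eq => s; have T := @fps2_truncP s.
exists (1 * fps2_trunc s f); first exact: fps2_agreeM (@fps2_agree1 s) (T f).
by rewrite mul1r; apply: T.
Qed.

Lemma fps2_mulDl : left_distributive fps2_mul +%R.
Proof.
move=> f g h; apply: fps2_eq => s; have T := @fps2_truncP s.
exists ((fps2_trunc s f + fps2_trunc s g) * fps2_trunc s h).
  exact: fps2_agreeM (fps2_agreeD (T f) (T g)) (T h).
rewrite mulrDl.
exact: fps2_agreeD (fps2_agreeM (T f) (T h)) (fps2_agreeM (T g) (T h)).
Qed.

Lemma fps2_one_neq0 : fps2_one != 0.
Proof. by apply/eqP => /(congr1 (fun f : fps2 => f (0, 0)%N)). Qed.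

HB.instance Definition _ := GRing.Zmodule_isComNzRing.Build fps2
  fps2_mulA fps2_mulC fps2_mul1 fps2_mulDl fps2_one_neq0.

Definition fps2_unit : {pred fps2} := fun f => `[< exists g : fps2, g * f = 1 >].

(* As for any unit ring, non-units are sent to themselves; series with constant
   coefficient 1, such as 1 - t_1^w with w > 0, are units. *)
Definition fps2_inv (f : fps2) : fps2 := xget f [set g | g * f = 1].

Lemma fps2_mulV : {in fps2_unit, left_inverse 1 fps2_inv *%R}.
Proof. by move=> f /asboolP[g gf]; apply: (@xgetPex _ f [set g | g * f = 1]); exists g. Qed.

Lemma fps2_unitP (f g : fps2) : g * f = 1 -> f \in fps2_unit.
Proof. by move=> gf; apply/asboolP; exists g. Qed.

Lemma fps2_inv_out : {in [predC fps2_unit], fps2_inv =1 id}.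
Proof. by move=> f /asboolPn nf; apply: xgetPN => g gf; apply: nf; exists g. Qed.

HB.instance Definition _ := GRing.ComNzRing_hasMulInverse.Build fps2
  fps2_mulV fps2_unitP fps2_inv_out.

Definition t1 : fps2 := fun s => (s == (1, 0)%N)%:R.
Definition t2 : fps2 := fun s => (s == (0, 1)%N)%:R.

Definition tpow (s : nat * nat) : fps2 := t1 ^+ s.1 * t2 ^+ s.2.

Section Dimension.
Variables (K : fieldType) (V : lmodType K).

Definition has_dim (W : set V) (d : nat) : Prop :=
  exists b : 'I_d -> V,
    (forall c : 'I_d -> K, \sum_i c i *: b i = 0 -> forall i, c i = 0) /\
    W = [set v | exists c : 'I_d -> K, v = \sum_i c i *: b i].

(* The dimension of a finite-dimensional subspace [W] (0 if there is none). *)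
Definition dimension (W : set V) : nat := xget 0%N [set d | has_dim W d].

End Dimension.

(* [a 1], ..., [a n] generate; other values of [a] are ignored. *)
Definition semigroup (n : nat) (a : nat -> nat * nat) : set (nat * nat) :=
  [set s | exists c : nat -> nat, s = \sum_(1 <= i < n.+1) a i *+ c i].

Definition monom (K : fieldType) (s : nat * nat) : {mpoly K[2]} :=
  'X_0 ^+ s.1 * 'X_1 ^+ s.2.
Arguments monom K s : clear implicits.

(* K[S]: the smallest K-subalgebra of K[t_1, t_2] containing t^s for s in S. *)
Definition semigroup_ring (K : fieldType) (S : set (nat * nat)) :
    set {mpoly K[2]} :=
  [set f | forall B : {pred {mpoly K[2]}}, GRing.subalg_closed B ->
     (forall s, S s -> monom K s \in B) -> f \in B].
Arguments semigroup_ring K S : clear implicits.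

Definition graded_piece (K : fieldType) (M : set {mpoly K[2]}) (s : nat * nat) :
    set {mpoly K[2]} :=
  M `&` [set f | exists c : K, f = c *: monom K s].

Definition hilbert_series (K : fieldType) (M : set {mpoly K[2]}) : fps2 :=
  fun s => (dimension (graded_piece M s))%:Z.

(* "s - v is in S", the difference being taken in Z^2. *)
Definition sub_in (S : set (nat * nat)) (s v : nat * nat) : Prop :=
  exists2 u, S u & u + v = s.

Definition shifts0 (S : set (nat * nat)) (v w : nat * nat) : set (nat * nat) :=
  [set s | [/\ S s, ~ sub_in S s v & ~ sub_in S s w]].

Definition shifts1 (S : set (nat * nat)) (v w : nat * nat) : set (nat * nat) :=
  [set s | [/\ S s, sub_in S s v, sub_in S s w & ~ sub_in S s (w + v)]].

Lemma semigroup0 n a : semigroup n a 0.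
Proof. by exists (fun=> 0%N); rewrite big1. Qed.

Lemma semigroupD n a s u :
  semigroup n a s -> semigroup n a u -> semigroup n a (s + u).
Proof.
move=> [c ->] [d ->]; exists (fun i => (c i + d i)%N).
by rewrite -big_split; apply: eq_bigr => i _; rewrite mulrnDr.
Qed.

Lemma monomE K s : monom K s = 'X_[(U_(0%R) *+ s.1 + U_(1%R) *+ s.2)%MM].
Proof. by rewrite /monom mpolyXD -!mpolyXn. Qed.

Lemma mem_semigroup_ring (K : fieldType) n a s (c : K) : c != 0 ->
  semigroup_ring K (semigroup n a) (c *: monom K s) <-> semigroup n a s.
Proof.
move=> c0; split => [|Ss B Bc BS]; last first.
  have [B1 Blin _] := Bc.
  have B0 : 0 \in B by rewrite -(addNr 1) -scaleN1r; apply: Blin.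
  by rewrite -[_ *: _]addr0; apply: Blin => //; apply: BS.
set S := semigroup n a.
pose e (m : 'X_{1..2}) : nat * nat := (m 0, m 1).
have eD m1 m2 : e (m1 + m2)%MM = e m1 + e m2 by rewrite /e !mnmDE.
have eX u : e (U_(0%R) *+ u.1 + U_(1%R) *+ u.2)%MM = u.
  by case: u => i j; rewrite /e !(mnmDE, mulmnE, mnm1E) /= !mul1n !mul0n addn0.
pose B : {pred {mpoly K[2]}} := fun f => `[< forall m, m \in msupp f -> S (e m) >].
move=> /(_ B) H.
have /asboolP/(_ (U_(0%R) *+ s.1 + U_(1%R) *+ s.2)%MM) : c *: monom K s \in B.
  apply: H => [|u Su].
    split.
    - apply/asboolP => m; rewrite msupp1 inE => /eqP ->.
      by rewrite /e !mnm0E; apply: semigroup0.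
    - move=> k f g /asboolP fB /asboolP gB; apply/asboolP => m /msuppD_le.
      by rewrite mem_cat => /orP[/msuppZ_le/fB|/gB].
    - move=> f g /asboolP fB /asboolP gB; apply/asboolP => m /msuppM_le.
      by move=> /allpairsP[[m1 m2] /= [/fB S1 /gB S2 ->]]; rewrite eD; apply: semigroupD.
  apply/asboolP => m; rewrite monomE msuppX inE => /eqP ->; by rewrite eX.
by rewrite eX; apply; rewrite mcoeff_msupp mcoeffZ monomE mcoeffX eqxx mulr1.
Qed.

(* HS_{K[S]}(t) is the sum of the t^s over all s in S. *)
Lemma hilbert_series_semigroup_ring (K : fieldType) n a s :
  hilbert_series (semigroup_ring K (semigroup n a)) s =
  `[< semigroup n a s >]%:R.
Proof.
rewrite /hilbert_series /dimension.
set W := graded_piece _ _.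
have mon0 : monom K s != 0.
  by rewrite monomE; apply/eqP => /(congr1 (mcoeff (U_(0%R) *+ s.1 + U_(1%R) *+ s.2)%MM))
    /eqP; rewrite mcoeffX eqxx mcoeff0 oner_eq0.
have W0 : W 0.
  split; last by exists 0; rewrite scale0r.
  by move=> B [B1 Blin _] _; rewrite -(addNr 1) -scaleN1r; apply: Blin.
have Wdim : has_dim W `[< semigroup n a s >].
  case: asboolP => Ss.
    exists (fun=> monom K s); split.
      move=> c; rewrite big_ord1 => /eqP; rewrite scaler_eq0 (negPf mon0) orbF.
      by move=> /eqP c0 i; rewrite ord1.
    apply/seteqP; split => [f [_ [c ->]]|f [c ->]] /=.
      by exists (fun=> c); rewrite big_ord1.
    rewrite big_ord1; split; last by exists (c ord0).
    have [->|c0] := eqVneq (c ord0) 0; first by rewrite scale0r; case: W0.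
    exact/mem_semigroup_ring.
  exists (fun=> 0); split; first by move=> c _ [].
  apply/seteqP; split => [f [Rf [c fc]]|f [c ->]] /=; last by rewrite big_ord0.
  exists (fun=> 0); rewrite big_ord0 fc.
  have [->|c0] := eqVneq c 0; first by rewrite scale0r.
  by case: Ss; apply/(@mem_semigroup_ring K n a s c c0); rewrite -fc.
have dim_le1 d : has_dim W d -> (d <= 1)%N.
  case: d => [|[|d]] // [b [bfree bW]].
  have Wb i : W (b i).
    rewrite bW; exists (fun j => (j == i)%:R).
    rewrite (bigD1 i) //= eqxx scale1r big1 ?addr0 // => j /negPf ->.
    by rewrite scale0r.
  have [_ [c0 b0]] := Wb ord0; have [_ [c1 b1]] := Wb ord_max.
  pose c (j : 'I_d.+2) := if j == ord0 then c1 else if j == ord_max then - c0 else 0.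
  have cz : \sum_i c i *: b i = 0.
    rewrite (bigD1 ord0) //= (bigD1 ord_max) //= big1 => [|j /andP[j0 j1]].
      by rewrite /c /= eqxx b0 b1 !scalerA addr0 -scalerDl mulNr mulrC subrr scale0r.
    by rewrite /c (negPf j0) (negPf j1) scale0r.
  have := bfree _ cz ord_max; rewrite /c /= eqxx => /eqP; rewrite oppr_eq0 => /eqP c00.
  suff /bfree/(_ ord0)/eqP : \sum_j (j == ord0)%:R *: b j = 0 by rewrite oner_eq0.
  rewrite (bigD1 ord0) //= b0 c00 scale0r scaler0 add0r.
  by rewrite big1 // => j /negPf ->; rewrite scale0r.
have dim0 : has_dim W 0 -> has_dim W 1 -> False.
  move=> [b [_ W_0]] [b' [free' W_1]].
  have : W (b' ord0) by rewrite W_1; exists (fun=> 1); rewrite big_ord1 scale1r.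
  rewrite W_0 => -[c]; rewrite big_ord0 => b'0.
  have /free'/(_ ord0)/eqP : \sum_(i < 1) 1 *: b' i = 0.
    by rewrite big_ord1 b'0 scaler0.
  by rewrite oner_eq0.
have := @xgetPex _ 0%N [set d | has_dim W d] (ex_intro _ _ Wdim).
move: (xget _ _) => d /= Wd; have := dim_le1 _ Wd; move: Wd Wdim.
by case: d => [|[|]] //; case: `[< _ >] => // h1 h2; case: dim0.
Qed.

(* Main.v *)
(* Write 1_A for the sum of the t^s with s in A. Multiplying 1_S by t^v gives the
   indicator series of v + S, so the coefficient of t^s in
   1_S (1 - t^v) (1 - t^w) is [s in S] - [s-v in S] - [s-w in S] + [s-v-w in S],
   and as S is stable under adding v and w this is 1 on S_0, -1 on S_1 and 0
   elsewhere. Finiteness of S_0 and S_1: if a_i has a nonzero first coordinate,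
   then w1 w2 a_i - v is in S, so an element u of S with u - v not in S uses each
   such a_i fewer than w1 w2 times and has bounded first coordinate; likewise for
   w and the second coordinate. For s in S_1 this applies to s - w and s - v,
   which have the same first, resp. second, coordinate as s. *)
Require Import Defs.
From mathcomp Require Import all_boot all_order all_algebra.
From mathcomp Require Import boolp classical_sets functions cardinality fsbigop.
From mathcomp Require Import finmap zify ring.
Import GRing.Theory.
Local Open Scope classical_set_scope.
Local Open Scope ring_scope.

(** * Indicator series of subsets of N^2: products, units and finite sums *)

Definition char_series (A : set (nat * nat)) : fps2 := fun s => `[< A s >]%:R.

Lemma fps2_mulE (f g : fps2) u : (f * g) u =
  \sum_(i < u.1.+1) \sum_(j < u.2.+1) f (i : nat, j : nat) * g (u.1 - i, u.2 - j)%N.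
Proof. by []. Qed.

Lemma fps2D (f g : fps2) u : (f + g) u = f u + g u.
Proof. by []. Qed.

Lemma fps2N (f : fps2) u : (- f) u = - f u.
Proof. by []. Qed.

Lemma char_set1E s u : char_series [set s] u = (u == s)%:R.
Proof. by rewrite /char_series /=; congr (nat_of_bool _)%:R; apply/asboolP/eqP. Qed.

(** In the Cauchy product at [u] only the term of index [s] survives. That index occurs only when
    [s] lies below [u] in both coordinates, and then truncated subtraction is exact. *)
Lemma char_set1_mul s (A : set (nat * nat)) :
  char_series [set s] * char_series A = char_series [set u | sub_in A u s].
Proof.
apply/funext => u; rewrite fps2_mulE.
have [/andP[le1 le2]|nle] := boolP ((s.1 <= u.1) && (s.2 <= u.2))%N.
  have lt1 : (s.1 < u.1.+1)%N by [].
  have lt2 : (s.2 < u.2.+1)%N by [].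
  rewrite (bigD1 (Ordinal lt1)) //= (bigD1 (Ordinal lt2)) //=.
  rewrite big1 => [|j jn]; last first.
    rewrite char_set1E; case: eqP => [e|]; last by rewrite mul0r.
    by case/eqP: jn; apply/val_inj/(congr1 snd e).
  rewrite big1 => [|i iN]; last first.
    apply: big1 => j _; rewrite char_set1E; case: eqP => [e|]; last by rewrite mul0r.
    by case/eqP: iN; apply/val_inj/(congr1 fst e).
  rewrite !addr0 char_set1E -surjective_pairing eqxx mul1r /char_series.
  congr (nat_of_bool _)%:R; apply/asboolP/asboolP => [Au|[r Ar ru]].
    exists (u.1 - s.1, u.2 - s.2)%N => //.
    by case: u s le1 le2 {lt1 lt2 Au} => [? ?] [? ?] /= le1 le2; congr pair; exact: subnK.
  suff -> : (u.1 - s.1, u.2 - s.2)%N = r by [].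
  rewrite -ru; case: r s {Ar ru le1 le2 lt1 lt2} => [? ?] [? ?].
  by congr pair; exact: addnK.
rewrite big1 => [|i _]; last first.
  apply: big1 => j _; rewrite char_set1E; case: eqP => [e|]; last by rewrite mul0r.
  by case/negP: nle; rewrite -e !leq_ord.
rewrite /char_series asboolF // => -[r _ ru]; case/negP: nle.
by rewrite -ru !leq_addl.
Qed.

Lemma char_set1M s r :
  char_series [set s] * char_series [set r] = char_series [set r + s].
Proof.
rewrite char_set1_mul; congr char_series; apply/seteqP; split=> [u [_ -> <-]//|u ->].
by exists r.
Qed.

Lemma char_set1X s k : char_series [set s] ^+ k = char_series [set s *+ k].
Proof.
elim: k => [|k IH]; first by apply/funext => u; rewrite expr0 char_set1E.
by rewrite exprS IH char_set1M addrC mulrS.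
Qed.

Lemma t1E : t1 = char_series [set (1, 0)%N].
Proof. by apply/funext => u; rewrite char_set1E. Qed.

Lemma t2E : t2 = char_series [set (0, 1)%N].
Proof. by apply/funext => u; rewrite char_set1E. Qed.

Lemma pair_addE (i j k l : nat) : (i, j) + (k, l) = (i + k, j + l)%N.
Proof. by []. Qed.

Lemma pair_mulrn (i j k : nat) : (i, j) *+ k = (i * k, j * k)%N.
Proof.
elim: k => [|k IH]; first by rewrite !muln0.
by rewrite mulrS IH !mulnS.
Qed.

Lemma tpowE s : tpow s = char_series [set s].
Proof.
rewrite /tpow t1E t2E !char_set1X char_set1M !pair_mulrn pair_addE.
by rewrite !mul0n !mul1n addn0 add0n -surjective_pairing.
Qed.

(** Geometric series: the inverse is the sum of the t^(ks), an indicator series because the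
    multiples of a nonzero [s] are distinct. *)
Lemma one_sub_char_unit s : s != 0 -> 1 - char_series [set s] \is a GRing.unit.
Proof.
move=> s0; apply/unitrPr.
exists (char_series [set u | exists k, u = s *+ k]).
rewrite mulrBl mul1r char_set1_mul; apply/funext => u.
rewrite fps2D fps2N /char_series /= -[RHS]/((u == 0)%:R).
have [->|u0] := eqVneq u 0.
  rewrite asboolT; last by exists 0%N.
  (* In N^2, [r + s = 0] forces [s = 0], so the shifted series has no constant term. *)
  rewrite asboolF ?subr0 // => -[r _ /eqP e]; case/negP: s0; move: e.
  case: r s => [? ?] [? ?]; rewrite !xpair_eqE => /andP[/= e1 e2].
  by move: e1 e2; rewrite !addn_eq0 => /andP[_ ->] /andP[_ ->].
apply/eqP; rewrite subr_eq0; apply/eqP; congr (nat_of_bool _)%:R.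
apply/asboolP/asboolP => [[[|k] e]|[r [k ->] <-]].
- by rewrite e eqxx in u0.
- by exists (s *+ k); [exists k | rewrite e mulrSr].
- by exists k.+1; rewrite mulrSr.
Qed.

(** Finiteness matters: over an infinite [A] the sum takes the default value 0. *)
Lemma fsum_tpow (A : set (nat * nat)) :
  finite_set A -> \sum_(s \in A) tpow s = char_series A.
Proof.
move=> Afin; rewrite fsbig_finite //=; apply/funext => u.
rewrite (big_morph (fun f : fps2 => f u) (id1 := 0) (op1 := +%R)) //.
under eq_bigr do rewrite tpowE char_set1E.
have [Au|Au] := pselect (A u).
  rewrite (big_fsetD1 u) /=; last by rewrite in_fset_set // mem_set.
  rewrite eqxx big1_fset => [|s]; first by rewrite addr0 /char_series asboolT.
  by rewrite in_fsetD1 eq_sym => /andP[/negPf ->].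
rewrite /char_series asboolF // big1_fset // => s.
rewrite in_fset_set // => /set_mem As _.
by case: eqP => // us; case: Au; rewrite us.
Qed.

(** * The numerator as a product with the denominator *)

Lemma char_series_shifts (S : set (nat * nat)) v w :
  (forall s, S s -> S (s + v)) -> (forall s, S s -> S (s + w)) ->
  char_series S * ((1 - char_series [set v]) * (1 - char_series [set w])) =
  char_series (shifts0 S v w) - char_series (shifts1 S v w).
Proof.
move=> Sv Sw.
have -> : char_series S * ((1 - char_series [set v]) * (1 - char_series [set w])) =
    char_series S - char_series [set v] * char_series S
    - char_series [set w] * char_series S
    + char_series [set w + v] * char_series S.
  by rewrite -char_set1M; ring.
rewrite !char_set1_mul; apply/funext => u.
rewrite !(fps2D, fps2N) /char_series /=.
(* These four implications leave six of the sixteen truth assignments for the four memberships; the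
   identity is then checked on each. *)
have SvS : sub_in S u v -> S u by move=> [r /Sv ? <-].
have SwS : sub_in S u w -> S u by move=> [r /Sw ? <-].
have SvwSv : sub_in S u (w + v) -> sub_in S u v.
  by move=> [r /Sw Sr <-]; exists (r + w); rewrite // addrA.
have SvwSw : sub_in S u (w + v) -> sub_in S u w.
  by move=> [r /Sv Sr <-]; exists (r + v); rewrite // addrAC -addrA.
have -> : `[< shifts0 S v w u >] =
    [&& `[< S u >], ~~ `[< sub_in S u v >] & ~~ `[< sub_in S u w >]].
  by rewrite -!asbool_neg; apply/asboolP/and3_asboolP.
have -> : `[< shifts1 S v w u >] =
    [&& `[< S u >], `[< sub_in S u v >], `[< sub_in S u w >]
      & ~~ `[< sub_in S u (w + v) >]].
  rewrite -asbool_neg; apply/asboolP/and4P => [[? ? ? ?]|[]]; first by split; apply/asboolP.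
  by move=> /asboolP ? /asboolP ? /asboolP ? /asboolP ?; split.
case: (asboolP (S u)); case: (asboolP (sub_in S u v));
  case: (asboolP (sub_in S u w)); case: (asboolP (sub_in S u (w + v))) => //=; tauto.
Qed.

(** * Finiteness of the two shift sets *)

Lemma semigroup_proj_bound n (a : nat -> nat * nat) (pr : nat * nat -> nat) w N u :
  pr 0 = 0%N -> {morph pr : x y / x + y >-> (x + y)%N} ->
  (forall i, (1 <= i <= n)%N -> (0 < pr (a i))%N ->
    exists2 r, semigroup n a r & a i *+ N = r + w) ->
  semigroup n a u -> ~ sub_in (semigroup n a) u w ->
  (pr u <= \sum_(1 <= i < n.+1) pr (a i) * N)%N.
Proof.
move=> pr0 prD aN [c ->] nw.
have prM x k : pr (x *+ k) = (pr x * k)%N.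
  by elim: k => [|k IH]; rewrite ?muln0 // mulrS prD IH mulnS.
rewrite (big_morph pr prD pr0) big_nat_cond [leqRHS]big_nat_cond.
apply: leq_sum => i /andP[ni _]; rewrite prM.
(* Generators with zero projection contribute nothing, however often they occur. For the others,
   more than [N] copies would let [N] of them be traded for [r + w], putting [u - w] in the
   semigroup. *)
have [->//|ai] := posnP (pr (a i)).
rewrite leq_mul2l; apply/orP; right; rewrite leqNgt; apply/negP => Nc.
have [r Sr ra] := aN i ni ai; apply: nw.
exists (r + \sum_(1 <= j < n.+1) a j *+ (c j - (j == i) * N)).
  by apply: semigroupD => //; exists (fun j => c j - (j == i) * N)%N.
have im : i \in index_iota 1 n.+1 by rewrite mem_index_iota.
rewrite addrAC -ra (bigD1_seq i) ?iota_uniq //= [RHS](bigD1_seq i) ?iota_uniq //=.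
rewrite eqxx mul1n addrA -mulrnDr subnKC ?(ltnW Nc) //; congr (_ + _).
by apply: eq_bigr => j /negPf ->; rewrite subn0.
Qed.

Lemma finite_box (A : set (nat * nat)) M1 M2 :
  (forall s, A s -> (s.1 <= M1)%N /\ (s.2 <= M2)%N) -> finite_set A.
Proof.
move=> AM; apply: (@sub_finite_set _ _ (`I_M1.+1 `*` `I_M2.+1)).
  by move=> s /AM[]; split.
by apply: finite_setX; apply: finite_II.
Qed.

Section Shifts.
Variables (n : nat) (a : nat -> nat * nat) (w1 w2 : nat).
Hypotheses (n_ge2 : (2 <= n)%N) (w1_gt0 : (0 < w1)%N) (w2_gt0 : (0 < w2)%N).
Hypotheses (a_penult : a n.-1 = (w1, 0)%N) (a_last : a n = (0, w2)%N).

Lemma semigroup_gen i : (1 <= i <= n)%N -> semigroup n a (a i).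
Proof.
move=> ni; exists (fun j => (j == i) : nat).
rewrite (bigD1_seq i) ?iota_uniq ?mem_index_iota //= eqxx mulr1n.
by rewrite big1 ?addr0 // => j /negPf ->.
Qed.

Lemma semigroup_axes x y : semigroup n a (w1 * x, w2 * y)%N.
Proof.
have mul s k : semigroup n a s -> semigroup n a (s *+ k).
  move=> Ss; elim: k => [|k IH]; first exact: semigroup0.
  by rewrite mulrS; apply: semigroupD.
have -> : (w1 * x, w2 * y)%N = a n.-1 *+ x + a n *+ y.
  by rewrite a_penult a_last !pair_mulrn pair_addE !mul0n addn0 add0n.
by apply: semigroupD; apply/mul/semigroup_gen; lia.
Qed.

Let S := semigroup n a.
Let M pr : nat := \sum_(1 <= i < n.+1) pr (a i) * (w1 * w2).

Lemma fst_bound u : S u -> ~ sub_in S u (a n.-1) -> (u.1 <= M fst)%N.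
Proof.
apply: semigroup_proj_bound => // i _ ai.
(* This is w1 w2 a_i - (w1, 0); the predecessor is a true one since [w2] and [(a i).1] are
   positive. *)
exists (w1 * (w2 * (a i).1).-1, w2 * (w1 * (a i).2))%N; first exact: semigroup_axes.
rewrite a_penult [a i]surjective_pairing pair_mulrn pair_addE /=; congr pair; last by lia.
rewrite -mulnSr prednK ?muln_gt0 ?w2_gt0 //; lia.
Qed.

Lemma snd_bound u : S u -> ~ sub_in S u (a n) -> (u.2 <= M snd)%N.
Proof.
apply: semigroup_proj_bound => // i _ ai.
exists (w1 * (w2 * (a i).1), w2 * (w1 * (a i).2).-1)%N; first exact: semigroup_axes.
rewrite a_last [a i]surjective_pairing pair_mulrn pair_addE /=; congr pair; first by lia.
rewrite -mulnSr prednK ?muln_gt0 ?w1_gt0 //; lia.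
Qed.

Lemma shifts0_finite : finite_set (shifts0 S (a n.-1) (a n)).
Proof.
apply: finite_box => s [Ss nv nw]; split; [exact: fst_bound | exact: snd_bound].
Qed.

Lemma shifts1_finite : finite_set (shifts1 S (a n.-1) (a n)).
Proof.
apply: finite_box => s [_ [u Su us] [r Sr rs] nvw]; split.
  (* Here [r] is s - a_n. If r - a_(n-1) were in [S], so would be s - a_n - a_(n-1). *)
  have -> : s.1 = r.1 by rewrite -rs a_last; exact: addn0.
  apply: fst_bound => // -[q Sq qr]; apply: nvw; exists q => //.
  by rewrite [a n + _]addrC addrA qr.
have -> : s.2 = u.2 by rewrite -us a_penult; exact: addn0.
apply: snd_bound => // -[q Sq qu]; apply: nvw; exists q => //.
by rewrite addrA qu.
Qed.

End Shifts.

(** * The Hilbert series as a quotient *)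

Theorem corollary3 (K : fieldType) (n : nat) (a : nat -> nat * nat)
    (w1 w2 : nat)
    (K_infinite : infinite_set [set: K])
    (n_ge2 : (2 <= n)%N)
    (a_neq0 : forall i : nat, (1 <= i <= n)%N -> a i <> (0, 0)%N)
    (w1_gt0 : (0 < w1)%N)
    (w2_gt0 : (0 < w2)%N)
    (a_penult : a n.-1 = (w1, 0)%N)
    (a_last : a n = (0, w2)%N) :
  hilbert_series (semigroup_ring K (semigroup n a)) =
    (\sum_(s \in shifts0 (semigroup n a) (a n.-1) (a n)) tpow s
     - \sum_(s \in shifts1 (semigroup n a) (a n.-1) (a n)) tpow s)
    / ((1 - t1 ^+ w1) * (1 - t2 ^+ w2)).
Proof.
have -> : hilbert_series (semigroup_ring K (semigroup n a)) =
    char_series (semigroup n a).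
  by apply/funext => s; exact: hilbert_series_semigroup_ring.
have Sa i : (1 <= i <= n)%N -> forall s, semigroup n a s -> semigroup n a (s + a i).
  by move=> ni s Ss; apply/semigroupD/semigroup_gen.
have Sv := Sa n.-1; have Sw := Sa n.
rewrite !fsum_tpow; last 2 first.
- exact: (shifts1_finite n a w1 w2).
- exact: (shifts0_finite n a w1 w2).
rewrite -char_series_shifts; last 2 first.
- by apply: Sv; lia.
- by apply: Sw; lia.
have t1w : t1 ^+ w1 = char_series [set a n.-1].
  by rewrite t1E char_set1X pair_mulrn a_penult mul1n mul0n.
have t2w : t2 ^+ w2 = char_series [set a n].
  by rewrite t2E char_set1X pair_mulrn a_last mul1n mul0n.
(* The right side is now the series of [S] times the denominator, divided by it; cancelling needs
   both factors to be units, which holds as [w1] and [w2] are positive. *)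
rewrite t1w t2w mulrK // unitrM.
by rewrite !one_sub_char_unit //
  ?a_penult ?a_last xpair_eqE negb_and -!lt0n ?w1_gt0 ?w2_gt0 ?orbT.
Qed.
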